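(* Let $1\le l<m$ be integers and $q$ a prime power. For the $q$-ary Grassmann code $C(l,m)$, with length $n$ and dimension $k=\binom{m}{l}$, the higher weights satisfy $d_k=n$ and $$d_{k-a}=n-(1+q+\dots+q^{a-1})\qquad\text{for } a=1,\dots,s,$$ where $s=\max(l,m-l)+1$.
   Context: $G(l,m)$ is the Grassmann variety of $l$-dimensional subspaces of an $m$-dimensional vector space over the finite field $F_q$, embedded in $\mathbf P^{k-1}$, $k=\binom{m}{l}$, by Plücker coordinates; $n=\frac{(q^m-1)(q^{m-1}-1)\cdots(q^{m-l+1}-1)}{(q^l-1)(q^{l-1}-1)\cdots(q-1)}$ is its number of $F_q$-rational points. The Grassmann code $C(l,m)$ is the linear $[n,k]$-code over $F_q$ (defined up to code equivalence) having as generator matrix a $k\times n$ matrix whose columns are representatives in $(F_q)^k$ of the $n$ $F_q$-rational points of $G(l,m)$. For a linear code $C$ of dimension $k$, the higher weights (support weights, generalized Hamming weights) $d_1<d_2<\dots<d_k$ are: $d_r$ is the minimum cardinality of the support of an $r$-dimensional subcode of $C$ (the support being the set of coordinate positions where some codeword of the subcode is nonzero); $d_0=0$. Equivalently, $d_r=n-H_r$, where $H_r$ is the maximum number of $F_q$-points of $G(l,m)$ contained in a codimension $r$ linear subspace of $\mathbf P^{k-1}$. *)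

(* Defs.v *)
From mathcomp Require Import all_boot all_order all_algebra.

Set Implicit Arguments.
Unset Strict Implicit.
Unset Printing Implicit Defensive.

Import GRing.Theory.
Local Open Scope ring_scope.

(* Linear subspaces of F^N are represented, as usual in mxalgebra, by the row
   spaces of matrices with N columns. *)

Definition code_support (F : finFieldType) (p n : nat) (D : 'M[F]_(p, n)) :
    {set 'I_n} :=
  [set j | [exists c : 'rV[F]_n, (c <= D)%MS && (c 0 j != 0)]].

(* [is_higher_weight C r d] says that d_r exists and equals d for the code C;
   a relation rather than a function, so that no default value enters when C
   has no r-dimensional subcode. *)
Definition is_higher_weight (F : finFieldType) (p n : nat) (C : 'M[F]_(p, n))
    (r d : nat) : Prop :=
  (exists D : 'M[F]_n,
     [/\ (D <= C)%MS, \rank D = r & #|code_support D| = d]) /\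
  (forall D : 'M[F]_n, (D <= C)%MS -> \rank D = r ->
     (d <= #|code_support D|)%N).

(* The i-th strictly increasing sequence of l column indices in {0,..,m-1},
   for a fixed enumeration of these sequences. *)
Definition plucker_index (l m : nat) (i : 'I_('C(m, l))) : l.-tuple 'I_m :=
  enum_val (cast_ord (esym (card_ltn_sorted_tuples l m)) i).

(* Maximal minors of a matrix whose rows form a basis of the subspace. *)
Definition plucker (F : finFieldType) (l m : nat) (A : 'M[F]_(l, m)) :
    'cV[F]_('C(m, l)) :=
  \col_i \det (colsub (tnth (plucker_index i)) A).

(* The division is exact: this is the Gaussian binomial coefficient. *)
Definition grassmann_length (q l m : nat) : nat :=
  ((\prod_(i < l) (q ^ (m - i) - 1)) %/ (\prod_(i < l) (q ^ (l - i) - 1)))%N.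

(* The A j list every l-dimensional subspace of F^m exactly once, and the
   j-th column of G is an arbitrary representative of the projective point
   with the Plücker coordinates of A j. *)
Definition grassmann_generator (F : finFieldType) (l m n : nat)
    (G : 'M[F]_('C(m, l), n)) : Prop :=
  exists A : 'I_n -> 'M[F]_(l, m),
    [/\ forall j, row_free (A j),
        forall B : 'M[F]_(l, m), row_free B -> exists! j, (A j == B)%MS
      & forall j, exists2 c : F, c != 0 & col j G = c *: plucker (A j)].

(* Main.v *)
Require Import Defs.
From mathcomp Require Import all_boot all_order all_algebra.
From mathcomp Require Import perm mxabelem zify.

Set Implicit Arguments.
Unset Strict Implicit.
Unset Printing Implicit Defensive.

Import GRing.Theory.
Local Open Scope ring_scope.

(** The r-dimensional subcodes of the Grassmann code are the products X G with X
    of rank r, because G has rank k.  Position j lies outside the support of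
    X G exactly when X kills column j of G, that is, when the Grassmann point j
    lies in the linear space U = ker X, of dimension a = k - r.  Hence
    d_(k-a) = n - (the largest number of Grassmann points in a linear space of
    dimension a).

    Distinct columns of G are distinct points of the projective space, by
    injectivity of the Plücker embedding [plucker_inj], so a space of dimension
    a contains at most 1 + q + ... + q^(a-1) of them, with equality as soon as
    each of its nonzero vectors is a multiple of a Plücker vector
    ([card_points_le] and [card_points_decomposable]).  Such spaces exist for
    a <= max(l, m-l) + 1, because the Grassmannian contains two families of
    large linear spaces: the subspaces through a fixed one of dimension l - 1
    form a projective space of dimension m - l ([decomposable_star]), and the
    hyperplanes of a fixed subspace of dimension l + 1 form a projective space
    of dimension l ([decomposable_hyperplanes]).  A linear space contained in
    either is again of this kind, which covers all smaller a; the case a = 0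
    is d_k = n.

    The rank of G is k because the coordinate subspaces have the unit vectors
    as their Plücker vectors ([generator_free]). *)

(** * Increasing index sequences *)

Lemma plucker_index_sorted (l m : nat) (i : 'I_('C(m, l))) :
  sorted ltn [seq val x | x <- plucker_index i].
Proof.
have := enum_valP (cast_ord (esym (card_ltn_sorted_tuples l m)) i).
by rewrite inE.
Qed.

Lemma plucker_index_uniq (l m : nat) (i : 'I_('C(m, l))) :
  uniq (plucker_index i).
Proof.
have := plucker_index_sorted i; rewrite ltn_sorted_uniq_leq => /andP[+ _].
by rewrite (map_inj_uniq val_inj).
Qed.

Lemma plucker_index_surj (l m : nat) (t : l.-tuple 'I_m) :
  sorted ltn [seq val x | x <- t] -> exists i, plucker_index i = t.
Proof.
move=> t_sorted; have tP :
    t \in [set u : l.-tuple 'I_m | sorted ltn [seq val x | x <- u]].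
  by rewrite inE.
exists (cast_ord (card_ltn_sorted_tuples l m) (enum_rank_in tP t)).
by rewrite /plucker_index cast_ord_comp cast_ord_id enum_rankK_in.
Qed.

Lemma plucker_index_inj_mem (l m : nat) (i j : 'I_('C(m, l))) :
  {subset plucker_index i <= plucker_index j} -> i = j.
Proof.
move=> sub_ij; have sz : (size (plucker_index j) <= size (plucker_index i))%N.
  by rewrite !size_tuple.
have [_ eq_ij] := uniq_min_size (plucker_index_uniq i) sub_ij sz.
suff /val_inj/enum_val_inj/cast_ord_inj :
  val (plucker_index i) = plucker_index j by [].
apply: (inj_map val_inj); apply: (irr_sorted_eq ltn_trans ltnn).
- exact: plucker_index_sorted.
- exact: plucker_index_sorted.
- exact: eq_mem_map eq_ij.
Qed.

(** * Plücker vectors and injectivity of the Plücker embedding *)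

Section PluckerVectors.

Variables (F : finFieldType) (l m : nat).

(** Column selections f that repeat a column give a zero minor, and the others
    differ from an increasing one by a permutation.  Having a functional w that
    serves all A at once is what transfers a relation between Plücker vectors
    to all minors. *)
Lemma minor_plucker (f : 'I_l -> 'I_m) :
  exists w : 'rV[F]_('C(m, l)),
    forall A : 'M_(l, m), \det (colsub f A) = (w *m plucker A) 0 0.
Proof.
have [/injectiveP f_inj|/injectivePn[i [j neq_ij eq_f]]] :=
  boolP (injectiveb f); last first.
  exists 0 => A; rewrite mul0mx mxE -det_tr.
  by apply: (determinant_alternate neq_ij) => b; rewrite !mxE eq_f.
pose r := relpre val leq : rel 'I_m.
pose tf := [tuple f b | b < l]; pose t := sort_tuple r tf.
have t_sorted : sorted ltn [seq val x | x <- t].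
  rewrite ltn_sorted_uniq_leq (map_inj_uniq val_inj) sort_uniq sorted_map.
  rewrite map_inj_uniq // -?enumT ?enum_uniq //=.
  by apply: sort_sorted => x y; apply: leq_total.
have [i def_t] := plucker_index_surj t_sorted.
have /tuple_permP[p def_p] : perm_eq tf (plucker_index i).
  by rewrite def_t perm_sym; apply/permPl/perm_sort.
exists ((-1) ^+ p^-1%g *: delta_mx 0 i) => A.
have -> : colsub f A = col_perm p (colsub (tnth (plucker_index i)) A).
  rewrite col_permEsub -colsub_comp; apply: eq_colsub => b /=.
  have /(congr1 (fun s : l.-tuple _ => tnth s b)) := val_inj def_p.
  by rewrite !tnth_mktuple.
by rewrite col_permE det_mulmx det_perm -scalemxAl -rowE !mxE mulrC.
Qed.

Lemma minor_proportional (A B : 'M[F]_(l, m)) (c : F) (f : 'I_l -> 'I_m) :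
  plucker A = c *: plucker B -> \det (colsub f A) = c * \det (colsub f B).
Proof.
by have [w wE] := minor_plucker f; move=> eqAB; rewrite !wE eqAB -scalemxAr mxE.
Qed.

Lemma row_free_minor (A : 'M[F]_(l, m)) :
  row_free A -> exists f : 'I_l -> 'I_m, \det (colsub f A) != 0.
Proof.
move=> freeA; have fullA : row_full A^T by rewrite /row_full mxrank_tr.
exists (fullrankfun fullA).
by rewrite -unitfE -unitmxE -unitmx_tr trmx_mxsub fullrowsub_unit.
Qed.

(** Once A is normalized so that its columns selected by f form the identity,
    replacing the i-th of them by column j yields a minor equal to entry (i, j).
    Thus the normalized basis of a subspace can be read off its minors. *)
Lemma normalized_entry (A : 'M[F]_(l, m)) (f : 'I_l -> 'I_m) i j :
  \det (colsub f A) != 0 ->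
  (invmx (colsub f A) *m A) i j =
    \det (colsub (fun b => if b == i then j else f b) A) / \det (colsub f A).
Proof.
set g := fun b : 'I_l => if b == i then j else f b.
rewrite -unitfE -unitmxE => unitAf.
pose N := invmx (colsub f A) *m A.
have Nf : colsub f N = 1%:M by rewrite -mulmx_colsub mulVmx.
have -> : \det (colsub g A) = \det (colsub f A) * \det (colsub g N).
  by rewrite -det_mulmx mulmx_colsub mulKVmx.
rewrite -/N [RHS]mulrC mulKr; last by rewrite -unitmxE.
rewrite (expand_det_col _ i) (bigD1 i) //= big1 => [|b neq_bi].
  (* The cofactors along column i ignore that column, so they are those of the
     identity. *)
  rewrite addr0.
  have -> : cofactor (colsub g N) i i = \adj (1%:M : 'M[F]_l) i i.
    rewrite mxE /cofactor -Nf; congr (_ * \det _).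
    by apply/matrixP => a b; rewrite !mxE /g eq_sym (negPf (neq_lift _ _)).
  by rewrite adj1 !mxE /g !eqxx mulr1.
have -> : cofactor (colsub g N) b i = \adj (1%:M : 'M[F]_l) i b.
  rewrite [RHS]mxE /cofactor -Nf; congr (_ * \det _).
  by apply/matrixP => a b'; rewrite !mxE /g (eq_sym _ i) (negPf (neq_lift _ _)).
by rewrite adj1 !mxE eq_sym (negPf neq_bi) mulr0.
Qed.

(** Proportional Plücker vectors have the same ratios of minors, so A and B have
    the same normalized basis. *)
Lemma plucker_inj (A B : 'M[F]_(l, m)) (c : F) :
  row_free A -> plucker A = c *: plucker B -> (A == B)%MS.
Proof.
move=> /row_free_minor[f Af_neq0] eqAB.
have minAB g := minor_proportional g eqAB.
have := Af_neq0; rewrite minAB mulf_eq0 negb_or => /andP[c_neq0 Bf_neq0].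
have eqN : invmx (colsub f A) *m A = invmx (colsub f B) *m B.
  apply/matrixP => i j; rewrite !normalized_entry // !minAB.
  by rewrite invfM mulrACA mulfV // mul1r.
have unit_of (M : 'M[F]_l) : \det M != 0 -> M \in unitmx.
  by rewrite unitmxE unitfE.
apply/andP; split; apply/submxP.
  exists (colsub f A *m invmx (colsub f B)).
  by rewrite -mulmxA -eqN mulKVmx ?unit_of.
exists (colsub f B *m invmx (colsub f A)).
by rewrite -mulmxA eqN mulKVmx ?unit_of.
Qed.

Lemma plucker_mulmx (M : 'M[F]_l) (A : 'M[F]_(l, m)) :
  plucker (M *m A) = \det M *: plucker A.
Proof. by apply/matrixP => i j; rewrite !mxE -mulmx_colsub det_mulmx. Qed.

Lemma plucker_eq0 (A : 'M[F]_(l, m)) : (plucker A == 0) = ~~ row_free A.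
Proof.
apply/eqP/idP => [A0|].
  apply/negP => /row_free_minor[f]; have [w ->] := minor_plucker f.
  by rewrite A0 mulmx0 mxE eqxx.
move=> notfreeA; apply/matrixP => a b; rewrite !mxE; apply/eqP.
apply: contraR notfreeA; rewrite -unitfE -unitmxE -row_free_unit -!row_leq_rank.
move=> /leq_trans; apply.
by rewrite -[A in colsub _ A]mulmx1 -mulmx_colsub mxrankM_maxl.
Qed.

(** The projective space of U lies in the Grassmannian: a nonzero Plücker vector
    is one of a matrix of full rank. *)
Definition decomposable (p : nat) (U : 'M[F]_(p, 'C(m, l))) : Prop :=
  forall y : 'rV_('C(m, l)), (y <= U)%MS -> y != 0 ->
    exists A : 'M_(l, m), exists c : F, y^T = c *: plucker A.

End PluckerVectors.

(** * Linear spaces on the Grassmannian *)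

(** Expansion along the first row makes the determinant linear in that row; a
    matrix P for this linear map gives access to its rank and its row space. *)
Lemma det_first_row (R : comNzRingType) (l p k : nat)
    (H : 'I_k -> 'M[R]_(p, 1 + l)) (E : 'I_k -> 'M[R]_(l, 1 + l)) :
  exists P : 'M_(p, k), forall x : 'rV_p,
    x *m P = \row_i \det (col_mx (x *m H i) (E i)).
Proof.
pose w i : 'cV_(1 + l) := \col_b cofactor (col_mx 0 (E i)) (lshift l 0) b.
have detE i (y : 'rV_(1 + l)) : \det (col_mx y (E i)) = (y *m w i) 0 0.
  rewrite (expand_det_row _ (lshift l 0)) mxE; apply: eq_bigr => b _.
  rewrite col_mxEu [X in _ = _ * X]mxE /cofactor; congr (_ * (_ * \det _)).
  apply/matrixP => a b'; rewrite !mxE; case: splitP => // o.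
  by rewrite ord1.
exists (\matrix_(a, i) (H i *m w i) a 0) => x; apply/rowP => i.
rewrite mxE [RHS]mxE detE -mulmxA [RHS]mxE.
by apply: eq_bigr => a _; rewrite !mxE.
Qed.

(** For a fixed E of dimension l - 1, the Plücker vector of the span of E and x
    is linear in x.  It vanishes only for x in E, so the image has dimension at
    least m - (l - 1). *)
Lemma decomposable_star (F : finFieldType) (l m : nat) :
  (0 < l <= m)%N ->
  exists2 P : 'M[F]_(m, 'C(m, l)), decomposable P & (m - l < \rank P)%N.
Proof.
case: l => // l /= lt_lm; pose E : 'M[F]_(l, m) := pid_mx l.
have [P PE] := det_first_row (fun i => colsub (tnth (plucker_index i)) 1%:M)
  (fun i : 'I_('C(m, l.+1)) => colsub (tnth (plucker_index i)) E).
have {}PE (x : 'rV_m) : (x *m P)^T = plucker (col_mx x E : 'M_(l.+1, m)).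
  rewrite PE; apply/colP => i; rewrite !mxE mulmx_colsub mulmx1; congr (\det _).
  by apply/matrixP => a b; rewrite !mxE; case: splitP => j _; rewrite !mxE.
exists P => [y /submxP[x ->] _|].
  by exists (col_mx x E : 'M_(l.+1, m)), 1; rewrite PE scale1r.
suff: (\rank (kermx P) <= l)%N.
  by rewrite mxrank_ker; move: lt_lm (\rank P) => {E PE}; lia.
have rankE : \rank E = l by rewrite rank_pid_mx // ltnW.
rewrite -[X in (_ <= X)%N]rankE; apply/mxrankS/row_subP => a.
set x := row a _; have : plucker (col_mx x E : 'M_(l.+1, m)) == 0.
  by rewrite -PE -row_mul mulmx_ker row0 trmx0.
rewrite plucker_eq0; apply: contraR => notxE.
rewrite -row_leq_rank -[\rank _]/(\rank (col_mx x E)) -addsmxE.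
have: (E < x + E)%MS by rewrite /ltmx addsmxSr addsmx_sub submx_refl andbT.
by move/rank_ltmx; rewrite rankE.
Qed.

(** A nonzero x in F^(l+1) is sent to the vector of the determinants of W_i
    bordered by the column x, where W_i consists of the columns of W selected
    by i.  A row operation N that turns x into a multiple of the first unit
    vector turns these determinants into the maximal minors of the last l rows
    of N W, whose row space is a hyperplane of that of W.  They are not all
    zero, so the map is injective. *)
Lemma decomposable_hyperplanes (F : finFieldType) (l m : nat) :
  (l < m)%N ->
  exists2 P : 'M[F]_(l.+1, 'C(m, l)), decomposable P & \rank P = l.+1.
Proof.
move=> lt_lm; pose W : 'M[F]_(1 + l, m) := pid_mx l.+1.
have freeW : row_free W by rewrite /row_free rank_pid_mx.
have [P PE] := det_first_row (fun _ : 'I_('C(m, l)) => 1%:M)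
  (fun i => (colsub (tnth (plucker_index i)) W)^T).
have {PE} decP (x : 'rV_(1 + l)) : x != 0 ->
    exists2 A : 'M_(l, m), row_free A &
      exists2 c, c != 0 & (x *m P)^T = c *: plucker A.
  move=> x_neq0; pose N := invmx (col_ebase x^T).
  have unitN : N \in unitmx by rewrite unitmx_inv col_ebase_unit.
  have rank_x : \rank x^T = 1%N by rewrite mxrank_tr rank_rV x_neq0.
  pose u := row_ebase x^T 0 0.
  have Nx : N *m x^T = col_mx u%:M 0.
    rewrite -[x^T in LHS]mulmx_ebase -mulmxA mulKmx ?col_ebase_unit // rank_x.
    rewrite [row_ebase _]mx11_scalar mul_mx_scalar.
    by rewrite pid_mx_col scale_col_mx scaler0 scalemx1.
  have u_neq0 : u != 0.
    have := row_ebase_unit x^T.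
    by rewrite [row_ebase _]mx11_scalar unitmxE det_scalar1 unitfE.
  have freeV : row_free (N *m W).
    by rewrite /row_free mxrankMfree // mxrank_unit.
  exists (dsubmx (N *m W)).
    apply: inj_row_free => v vV0.
    have : row_mx (0 : 'rV_1) v *m (N *m W) = 0.
      by rewrite -[N *m W]vsubmxK mul_row_col mul0mx vV0 addr0.
    rewrite -(mul0mx _ (N *m W)) => /(row_free_inj freeV)/(congr1 rsubmx).
    by rewrite row_mxKr linear0.
  exists ((\det N)^-1 * u); first by rewrite mulf_neq0 // invr_eq0 -unitfE -unitmxE.
  rewrite PE; apply/colP => i; rewrite !mxE mulmx1.
  rewrite -det_tr tr_col_mx trmxK.
  set R := row_mx _ _.
  have -> : \det R = (\det N)^-1 * \det (N *m R).
    by rewrite det_mulmx mulKf // -unitfE -unitmxE.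
  rewrite -mulrA; congr (_ * _).
  rewrite mul_mx_row Nx mulmx_colsub.
  set V := N *m W; rewrite -[V in LHS]vsubmxK.
  set f := tnth _; have -> : colsub f (col_mx (usubmx V) (dsubmx V)) =
      col_mx (colsub f (usubmx V)) (colsub f (dsubmx V)).
    by apply/matrixP => a b; rewrite !mxE; case: splitP => j _; rewrite !mxE.
  by rewrite -block_mxEh det_ublock det_scalar1.
exists P.
  move=> y /submxP[x ->] xP.
  have /decP[A _ [c _ xA]] : x != 0 by apply: contraNneq xP => ->; rewrite mul0mx.
  by exists A, c.
apply/eqP/inj_row_free => x xP0; apply: contraTeq isT => /decP[A freeA [c c_neq0]].
by rewrite xP0 trmx0 => /esym/eqP; rewrite scaler_eq0 (negPf c_neq0) plucker_eq0 freeA.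
Qed.

Lemma decomposable_subspace (F : finFieldType) (l m p a : nat)
    (P : 'M[F]_(p, 'C(m, l))) :
  decomposable P -> (a <= \rank P)%N ->
  exists2 U : 'M[F]_(a, 'C(m, l)), decomposable U & \rank U = a.
Proof.
move=> decP le_a; exists (pid_mx a *m row_base P); last first.
  by rewrite mxrankMfree ?row_base_free // rank_pid_mx.
move=> y yU; apply: decP; apply: submx_trans yU _.
by rewrite -(eq_row_base P) submxMl.
Qed.

Lemma exists_decomposable (F : finFieldType) (l m a : nat) :
  (0 < l < m)%N -> (a <= (maxn l (m - l)).+1)%N ->
  exists2 U : 'M[F]_(a, 'C(m, l)), decomposable U & \rank U = a.
Proof.
case/andP=> l_gt0 lt_lm; case: (leqP l (m - l)) => _ le_a.
  have [|P decP rankP] := @decomposable_star F l m; first by rewrite l_gt0 ltnW.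
  exact: decomposable_subspace decP (leq_trans le_a rankP).
have [P decP rankP] := decomposable_hyperplanes F lt_lm.
by apply: decomposable_subspace decP _; rewrite rankP.
Qed.

(** * Grassmann points in a linear space, and weights of the Grassmann code *)

Section GrassmannCode.

Variables (F : finFieldType) (l m n : nat).
Variables (G : 'M[F]_('C(m, l), n)) (A : 'I_n -> 'M[F]_(l, m)).
Hypothesis A_free : forall j, row_free (A j).
Hypothesis A_enum :
  forall B : 'M[F]_(l, m), row_free B -> exists! j, (A j == B)%MS.
Hypothesis G_plucker :
  forall j, exists2 c : F, c != 0 & col j G = c *: plucker (A j).

Lemma generator_col_eq0 j : (col j G == 0) = false.
Proof.
have [c c_neq0 ->] := G_plucker j.
by rewrite scaler_eq0 (negPf c_neq0) plucker_eq0 A_free.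
Qed.

Lemma generator_col_inj i j (c : F) : col i G = c *: col j G -> i = j.
Proof.
have [ci ci_neq0 ->] := G_plucker i; have [cj cj_neq0 ->] := G_plucker j.
move=> eq_ij; have /(plucker_inj (A_free i)) eqA :
    plucker (A i) = (ci^-1 * c * cj) *: plucker (A j).
  by rewrite -!scalerA -eq_ij scalerA mulVf // scale1r.
have [k [_ k_uniq]] := A_enum (A_free j).
by rewrite -(k_uniq i) // -(k_uniq j) // submx_refl.
Qed.

Lemma plucker_generator_col (B : 'M[F]_(l, m)) :
  row_free B -> exists j, exists2 c : F, c != 0 & plucker B = c *: col j G.
Proof.
move=> freeB; have [j [/eqmxP eqAB _]] := A_enum freeB; exists j.
have [c c_neq0 ->] := G_plucker j.
have /submxP[M def_B] : (B <= A j)%MS by rewrite eqAB.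
have := plucker_eq0 B.
rewrite freeB def_B plucker_mulmx scaler_eq0 => /negbT.
rewrite negb_or => /andP[M_neq0 _].
exists (\det M / c); first by rewrite mulf_neq0 ?invr_eq0.
by rewrite scalerA mulfVK.
Qed.

(** The subspace spanned by the unit vectors e_b, b in the i-th index sequence,
    has the i-th unit vector as its Plücker vector. *)
Lemma generator_free : row_free G.
Proof.
rewrite /row_free -mxrank_tr -/(row_full G^T) -sub1mx; apply/row_subP => i.
pose B : 'M[F]_(l, m) := \matrix_(a, b) (tnth (plucker_index i) a == b)%:R.
have plB : plucker B = delta_mx i 0.
  apply/matrixP => j z; rewrite ord1 !mxE eqxx andbT eq_sym.
  have [<-|neq_ij] := eqVneq i j.
    rewrite -[RHS](det1 F l); congr (\det _); apply/matrixP => a b; rewrite !mxE.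
    by rewrite (inj_eq (tuple_uniqP _ (plucker_index_uniq i))).
  (* Row a of this minor is zero, as i selects a column that j omits. *)
  have [a aNj] : exists a, tnth (plucker_index i) a \notin plucker_index j.
    apply/existsP; apply: contra_neqT neq_ij.
    rewrite negb_exists => /forallP sub_ij.
    apply: plucker_index_inj_mem => _ /tnthP[a ->].
    by have := sub_ij a; rewrite negbK.
  rewrite (expand_det_row _ a) big1 // => b _; rewrite !mxE.
  case: eqP => [eq_ab|_]; last by rewrite mul0r.
  by rewrite eq_ab mem_tnth in aNj.
have [|j [c c_neq0 plBj]] := @plucker_generator_col B.
  rewrite -[row_free B]negbK -plucker_eq0 plB.
  by apply/eqP => /matrixP/(_ i 0)/eqP; rewrite !mxE !eqxx oner_eq0.
rewrite row1 -[delta_mx 0 i]trmxK trmx_delta -plB plBj linearZ /= tr_col.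
by rewrite scalemx_sub // row_sub.
Qed.

Definition points_in p (U : 'M[F]_(p, 'C(m, l))) : {set 'I_n} :=
  [set j | ((col j G)^T <= U)%MS].

(** Each Grassmann point in U accounts for q - 1 of the q^a - 1 nonzero vectors
    of U; these vectors, rather than the projective points of U, are counted. *)
Definition representatives p (U : 'M[F]_(p, 'C(m, l))) :
    {set 'rV[F]_('C(m, l))} :=
  [set jc.2 *: (col jc.1 G)^T | jc in setX (points_in U) [set~ 0]].

Lemma card_representatives p (U : 'M[F]_(p, 'C(m, l))) :
  #|representatives U| = (#|points_in U| * #|F|.-1)%N.
Proof.
rewrite card_in_imset; first by rewrite cardsX cardsC1.
case=> [i c] [j d]; rewrite !inE /= => /andP[_ c_neq0] /andP[_ d_neq0].
move/(congr1 trmx); rewrite !linearZ /= !trmxK => eq_cd.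
have eq_ij : i = j.
  apply: (@generator_col_inj _ _ (c^-1 * d)).
  by rewrite -scalerA -eq_cd scalerA mulVf // scale1r.
rewrite eq_ij in eq_cd *; congr (_, _); apply/eqP; rewrite -subr_eq0.
have /eqP := eq_cd; rewrite -subr_eq0 -scalerBl scaler_eq0.
by rewrite generator_col_eq0 orbF.
Qed.

Lemma card_nonzero_rowg p k (U : 'M[F]_(p, k)) :
  #|rowg U :\ 0| = (#|F|.-1 * \sum_(i < \rank U) #|F| ^ i)%N.
Proof. by rewrite -predn_exp -card_rowg (cardsD1 0 (rowg U)) mem_rowg sub0mx. Qed.

Lemma representatives_sub p (U : 'M[F]_(p, 'C(m, l))) :
  representatives U \subset rowg U :\ 0.
Proof.
apply/subsetP => y; rewrite in_setD1 mem_rowg => /imsetP[[j c]].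
rewrite !inE => /andP[/= Uj c_neq0] ->; rewrite scalemx_sub // andbT.
by rewrite scaler_eq0 negb_or c_neq0 trmx_eq0 generator_col_eq0.
Qed.

Lemma representatives_decomposable p (U : 'M[F]_(p, 'C(m, l))) :
  decomposable U -> representatives U = rowg U :\ 0.
Proof.
move=> decU; apply/eqP; rewrite eqEsubset representatives_sub.
apply/subsetP => y; rewrite in_setD1 mem_rowg => /andP[y_neq0 yU].
have [B [c yE]] := decU y yU y_neq0.
have freeB : row_free B.
  rewrite -[row_free B]negbK -plucker_eq0; apply: contraNneq y_neq0 => B0.
  by rewrite -trmx_eq0 yE B0 scaler0.
have [j [d d_neq0 plB]] := plucker_generator_col freeB.
have {}yE : y = (c * d) *: (col j G)^T.
  by rewrite -[y]trmxK yE plB scalerA linearZ.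
have cd_neq0 : c * d != 0.
  by apply: contraNneq y_neq0 => cd0; rewrite yE cd0 scale0r.
apply/imsetP; exists (j, c * d) => //; rewrite !inE /= cd_neq0 andbT.
by move: yU; rewrite yE (eqmx_scale _ cd_neq0).
Qed.

Lemma predq_gt0 : (0 < #|F|.-1)%N.
Proof. by have := card_finNzRing_gt1 F; case: #|F| => [|[]]. Qed.

Lemma card_points_le p (U : 'M[F]_(p, 'C(m, l))) :
  (#|points_in U| <= \sum_(i < \rank U) #|F| ^ i)%N.
Proof.
rewrite -(leq_pmul2r predq_gt0) -card_representatives [X in (_ <= X)%N]mulnC.
by rewrite -card_nonzero_rowg subset_leq_card ?representatives_sub.
Qed.

Lemma card_points_decomposable p (U : 'M[F]_(p, 'C(m, l))) :
  decomposable U -> #|points_in U| = (\sum_(i < \rank U) #|F| ^ i)%N.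
Proof.
move=> decU; apply/eqP; rewrite -(eqn_pmul2r predq_gt0) -card_representatives.
by rewrite representatives_decomposable // card_nonzero_rowg mulnC.
Qed.

Lemma code_support_points p q (D : 'M[F]_(p, n)) (X : 'M[F]_(q, 'C(m, l))) :
  (D :=: X *m G)%MS -> ~: code_support D = points_in (kermx X^T).
Proof.
move=> eqD; apply/setP => j; rewrite !inE negb_exists.
rewrite sub_kermx -trmx_mul trmx_eq0 colE mulmxA -colE.
apply/forallP/eqP => [vanish|Xj0 c].
  apply/colP => i; rewrite mxE [RHS]mxE.
  have := vanish (row i (X *m G)); rewrite eqD row_sub mxE /=.
  by rewrite negbK => /eqP.
rewrite eqD; apply/negP => /andP[/submxP[w ->]].
apply/negP; rewrite negbK; have := congr1 (fun v => (w *m v) 0 0) Xj0.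
by rewrite mulmx0 colE mulmxA -colE !mxE => ->.
Qed.

Lemma card_code_support p q (D : 'M[F]_(p, n)) (X : 'M[F]_(q, 'C(m, l))) :
  (D :=: X *m G)%MS -> #|code_support D| = (n - #|points_in (kermx X^T)|)%N.
Proof.
by move=> /code_support_points <-; rewrite -[X in (X - _)%N](card_ord n) cardsCs.
Qed.

(** The subcode attaining the weight comes from a matrix X with kernel U; for any
    other subcode of that dimension the kernel again has dimension a, and so
    contains no more Grassmann points than U. *)
Lemma higher_weight_generator a (U : 'M[F]_(a, 'C(m, l))) :
  decomposable U -> \rank U = a ->
  is_higher_weight G ('C(m, l) - a) (n - \sum_(i < a) #|F| ^ i).
Proof.
move=> decU rankU; have le_ak : (a <= 'C(m, l))%N by rewrite -rankU rank_leq_col.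
split=> [|D DG rankD].
  pose X := (cokermx U)^T; exists <<X *m G>>%MS; split.
  - by rewrite genmxE submxMl.
  - by rewrite genmxE mxrankMfree ?generator_free // mxrank_tr mxrank_coker rankU.
  - rewrite (card_code_support (genmxE _)) -[in RHS]rankU -card_points_decomposable //.
    congr (_ - #|pred_of_set _|)%N; apply/setP => j.
    by rewrite !inE sub_kermx trmxK -submxE.
have eqD : (D :=: D *m pinvmx G *m G)%MS by rewrite mulmxKpV.
rewrite (card_code_support eqD); apply: leq_sub2l.
apply: leq_trans (card_points_le _) _; rewrite mxrank_ker mxrank_tr.
by rewrite -(mxrankMfree _ generator_free) mulmxKpV // rankD subKn.
Qed.

End GrassmannCode.

Theorem theorem4p3 (F : finFieldType) (l m : nat)
    (hl : (1 <= l)%N) (hlm : (l < m)%N)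
    (G : 'M[F]_('C(m, l), grassmann_length #|F| l m))
    (hG : grassmann_generator G) :
  let q := #|F| in
  let k := 'C(m, l) in
  let n := grassmann_length q l m in
  let s := (maxn l (m - l)).+1 in
  is_higher_weight G k n /\
  (forall a : nat, (1 <= a <= s)%N ->
     is_higher_weight G (k - a) (n - \sum_(i < a) q ^ i)%N).
Proof.
case: hG => A [A_free A_enum G_plucker] q k n s.
have weight a : (a <= s)%N -> is_higher_weight G (k - a) (n - \sum_(i < a) q ^ i).
  have lm : (0 < l < m)%N by rewrite hl.
  move=> /(exists_decomposable F lm)[U decU rankU].
  exact: (higher_weight_generator A_free A_enum G_plucker decU rankU).
split=> [|a /andP[_ /weight //]].
by have := weight 0%N isT; rewrite big_ord0 !subn0.
Qed.
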